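(* As formal power series in $q$, $$\sum_{n=0}^{\infty} S(2n)q^n = \frac{f_2f_8f_{12}^2}{f_1f_3f_4f_6f_{24}},\qquad \sum_{n=0}^{\infty} S(2n+1)q^n = \frac{f_4^2f_{24}}{f_1f_3f_8f_{12}}.$$
   Context: Let $(a;q)_\infty:=\prod_{k\geq 0}(1-aq^k)$ and, for a positive integer $r$, $f_r:=(q^r;q^r)_\infty=\prod_{k\geq1}(1-q^{rk})$. The function $S(n)$ (the number of overpartitions of $n$ of Schur-type, in the sense of Broudy and Lovejoy) is defined by the generating function $$\sum_{n=0}^{\infty} S(n)q^n = \frac{1}{(q;q^6)_\infty(q^5;q^6)_\infty(q^6;q^6)_\infty}.$$ *)

(* Defs.v *)
From HB Require Import structures.
From mathcomp Require Import all_boot all_order all_algebra.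
From mathcomp Require Import boolp classical_sets.

Set Implicit Arguments.
Unset Strict Implicit.
Unset Printing Implicit Defensive.

Import GRing.Theory.

Local Open Scope ring_scope.

(* [FPS a] is the generating function of the sequence [a].                    *)
Record fps (R : Type) : Type := FPS { fps_coef : nat -> R }.

Notation "u `[ n ]" := (fps_coef u n)
  (at level 2, left associativity, format "u `[ n ]").

Lemma fpsP (R : Type) (u v : fps R) : (forall n, u`[n] = v`[n]) <-> u = v.
Proof.
split=> [|-> //]; case: u v => [a] [b] /= eq_ab.
by congr FPS; apply/funext.
Qed.

HB.instance Definition _ (R : Type) := gen_eqMixin (fps R).
HB.instance Definition _ (R : Type) := gen_choiceMixin (fps R).

Section FpsZmodule.
Context {R : zmodType}.
Implicit Types u v w : fps R.

Definition fps_zero : fps R := FPS (fun=> 0).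
Definition fps_opp u : fps R := FPS (fun n => - u`[n]).
Definition fps_add u v : fps R := FPS (fun n => u`[n] + v`[n]).

Fact fps_addA : associative fps_add.
Proof. by move=> u v w; apply/fpsP => n /=; rewrite addrA. Qed.
Fact fps_addC : commutative fps_add.
Proof. by move=> u v; apply/fpsP => n /=; rewrite addrC. Qed.
Fact fps_add0 : left_id fps_zero fps_add.
Proof. by move=> u; apply/fpsP => n /=; rewrite add0r. Qed.
Fact fps_addN : left_inverse fps_zero fps_opp fps_add.
Proof. by move=> u; apply/fpsP => n /=; rewrite addNr. Qed.

HB.instance Definition _ :=
  GRing.isZmodule.Build (fps R) fps_addA fps_addC fps_add0 fps_addN.

Lemma coef0fps n : (0 : fps R)`[n] = 0. Proof. by []. Qed.
Lemma coefNfps u n : (- u)`[n] = - u`[n]. Proof. by []. Qed.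
Lemma coefDfps u v n : (u + v)`[n] = u`[n] + v`[n]. Proof. by []. Qed.
Lemma coefBfps u v n : (u - v)`[n] = u`[n] - v`[n]. Proof. by []. Qed.
Lemma coef_sumfps (I : Type) (r : seq I) (P : pred I) (F : I -> fps R) n :
  (\sum_(i <- r | P i) F i)`[n] = \sum_(i <- r | P i) (F i)`[n].
Proof. by elim/big_rec2: _ => // i x u _ <-. Qed.

End FpsZmodule.

Section FpsRing.
Context {R : comNzRingType}.
Implicit Types u v w : fps R.

Definition fps_one : fps R := FPS (fun n => (n == 0%N)%:R).
Definition fps_mul u v : fps R :=
  FPS (fun n => \sum_(i < n.+1) u`[i] * v`[n - i]).

Definition fps_trunc N u : {poly R} := \poly_(i < N) u`[i].

Let mulE (p q : {poly R}) u v n :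
    (forall i, (i <= n)%N -> p`_i = u`[i]) ->
    (forall i, (i <= n)%N -> q`_i = v`[i]) ->
  (fps_mul u v)`[n] = (p * q)`_n.
Proof.
move=> eq_pu eq_qv; rewrite coefM /=; apply: eq_bigr => i _.
by rewrite eq_pu ?eq_qv ?leq_subr // -ltnS.
Qed.

Let truncE N u i : (i < N)%N -> (fps_trunc N u)`_i = u`[i].
Proof. by move=> ltiN; rewrite coef_poly ltiN. Qed.

Fact fps_mulC : commutative fps_mul.
Proof.
move=> u v; apply/fpsP => n; pose T := fps_trunc n.+1.
rewrite (mulE (p := T u) (q := T v)) 1?(mulE (p := T v) (q := T u)) 1?mulrC //.
all: by move=> i lein; apply: truncE.
Qed.

Fact fps_mulA : associative fps_mul.
Proof.
move=> u v w; apply/fpsP => n; pose T := fps_trunc n.+1.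
have TE x i : (i <= n)%N -> (T x)`_i = x`[i] by move=> ?; apply: truncE.
have TM x y i : (i <= n)%N -> (T x * T y)`_i = (fps_mul x y)`[i].
  by move=> lein; rewrite (mulE (p := T x) (q := T y)) => [|j leji|j leji] //; apply: TE;
     apply: leq_trans lein.
rewrite (mulE (p := T u) (q := T v * T w)) => [|i|i]; [|exact: TE|exact: TM].
rewrite (mulE (p := T u * T v) (q := T w)) => [|i|i]; [|exact: TM|exact: TE].
by rewrite mulrA.
Qed.

Fact fps_mul1 : left_id fps_one fps_mul.
Proof.
move=> u; apply/fpsP => n /=; rewrite big_ord_recl /= mul1r subn0.
by rewrite big1 ?addr0 // => i _; rewrite mul0r.
Qed.

Fact fps_mulDl : left_distributive fps_mul +%R.
Proof.
move=> u v w; apply/fpsP => n /=; rewrite -big_split /=.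
by apply: eq_bigr => i _; rewrite mulrDl.
Qed.

Fact fps_one_neq0 : fps_one != 0.
Proof.
by apply/eqP => /fpsP/(_ 0%N)/eqP; rewrite coef0fps /= oner_eq0.
Qed.

HB.instance Definition _ := GRing.Zmodule_isComNzRing.Build (fps R)
  fps_mulA fps_mulC fps_mul1 fps_mulDl fps_one_neq0.

Lemma coef1fps n : (1 : fps R)`[n] = (n == 0%N)%:R. Proof. by []. Qed.
Lemma coefMfps u v n :
  (u * v)`[n] = \sum_(i < n.+1) u`[i] * v`[n - i].
Proof. by []. Qed.

Lemma coef0Mfps u v : (u * v)`[0] = u`[0] * v`[0].
Proof. by rewrite coefMfps big_ord1. Qed.

Lemma coefX_eq0 u k n : u`[0] = 0 -> (n < k)%N -> (u ^+ k)`[n] = 0.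
Proof.
move=> u0; elim: k n => // k IHk n ltnk; rewrite exprS coefMfps.
rewrite big_ord_recl u0 mul0r add0r big1 // => i _.
rewrite IHk ?mulr0 //=; apply: leq_trans (ltnk : (n <= k)%N).
by rewrite /bump add1n ltn_subrL (leq_ltn_trans (leq0n i) (ltn_ord i)).
Qed.

End FpsRing.

Section FpsUnitRing.
Context {R : comUnitRingType}.
Implicit Types u v w : fps R.

Definition fps_unit : {pred fps R} := fun u => u`[0] \is a GRing.unit.

(* For w := 1 - u / u_0 we have w_0 = 0 and u^-1 = u_0^-1 * \sum_k w^k; only  *)
(* the powers k <= n contribute to the coefficient of q^n.                    *)
Definition fps_inv u : fps R :=
  if u \in fps_unit then
    let w := 1 - FPS (fun n => u`[0]^-1 * u`[n]) in
    FPS (fun n => u`[0]^-1 * \sum_(k < n.+1) (w ^+ k)`[n])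
  else u.

Fact fps_mulVr : {in fps_unit, left_inverse 1 fps_inv *%R}.
Proof.
move=> u uU; rewrite /fps_inv uU; set w := 1 - _.
have u0U : u`[0] \is a GRing.unit by [].
have w0 : w`[0] = 0 by rewrite coefBfps /= mulVr // subrr.
apply/fpsP => n; pose G : fps R := \sum_(k < n.+1) w ^+ k.
transitivity ((G * (1 - w))`[n]); last first.
  rewrite mulrC -opprB mulNr -subrX1 coefNfps coefBfps coefX_eq0 //.
  by rewrite sub0r opprK.
rewrite !coefMfps; apply: eq_bigr => i _ /=.
have -> : G`[i] = \sum_(k < i.+1) (w ^+ k)`[i].
  rewrite coef_sumfps [RHS](big_ord_widen n.+1 (fun k => (w ^+ k)`[i])) //.
  rewrite [RHS]big_mkcond; apply: eq_bigr => k _.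
  by case: ltnP => // ltik; rewrite coefX_eq0.
by rewrite /w subKr /= mulrCA mulrA.
Qed.

Fact fps_unitPl u v : v * u = 1 -> fps_unit u.
Proof.
move/fpsP/(_ 0%N); rewrite coef0Mfps coef1fps => vu1.
by apply/unitrP; exists v`[0]; split=> //; rewrite mulrC.
Qed.

Fact fps_inv_out : {in [predC fps_unit], fps_inv =1 id}.
Proof. by move=> u; rewrite inE /fps_inv /= => /negbTE ->. Qed.

HB.instance Definition _ := GRing.ComNzRing_hasMulInverse.Build (fps R)
  fps_mulVr fps_unitPl fps_inv_out.

Lemma fps_unitE u : (u \is a GRing.unit) = (u`[0] \is a GRing.unit).
Proof. by []. Qed.

End FpsUnitRing.

Arguments fps_coef : simpl never.

Section InfiniteProducts.
Context {R : comNzRingType}.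
Implicit Types (u v : nat -> fps R) (P Q a q : fps R).

Definition fpsX : fps R := FPS (fun n => (n == 1%N)%:R).

(* Convergence of the partial products in the X-adic topology.                *)
Definition infprod_cvg u P : Prop :=
  forall n, exists N, forall m, (N <= m)%N -> (\prod_(k < m) u k)`[n] = P`[n].

Definition infprod u : fps R := xget 0 [set P | infprod_cvg u P].

(* (a; q)_oo                                                                  *)
Definition qpoch a q : fps R := infprod (fun k => 1 - a * q ^+ k).

Lemma infprod_cvg_unique u P Q : infprod_cvg u P -> infprod_cvg u Q -> P = Q.
Proof.
move=> uP uQ; apply/fpsP => n; have [[N NP] [M MQ]] := (uP n, uQ n).
by rewrite -(NP (maxn N M)) ?leq_maxl // -(MQ (maxn N M)) ?leq_maxr.
Qed.

Lemma infprodE u P : infprod_cvg u P -> infprod u = P.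
Proof.
move=> uP; rewrite /infprod (xget_unique 0 uP) // => Q uQ.
exact: infprod_cvg_unique uQ uP.
Qed.

Lemma coef_fpsXn k n : (fpsX ^+ k)`[n] = (n == k)%:R.
Proof.
elim: k n => // k IHk [|n]; first by rewrite exprS coef0Mfps mul0r.
rewrite exprS coefMfps big_ord_recl mul0r add0r big_ord_recl big1 => [|i _].
  by rewrite addr0 mul1r IHk subSS subn0.
by rewrite mul0r.
Qed.

Lemma qpoch_cvg (a b : nat) : (0 < a)%N -> (0 < b)%N ->
  infprod_cvg (fun k => 1 - fpsX ^+ a * (fpsX ^+ b) ^+ k)
    (qpoch (fpsX ^+ a) (fpsX ^+ b)).
Proof.
move=> a0 b0; rewrite /qpoch.
set u : nat -> fps R := fun k => 1 - fpsX ^+ a * (fpsX ^+ b) ^+ k.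
pose P : fps R := FPS (fun n => (\prod_(k < n) u k)`[n]).
suff uP : infprod_cvg u P by rewrite (infprodE uP).
move=> n; exists n; elim=> [|m IHm]; first by rewrite leqn0 => /eqP->.
rewrite leq_eqVlt => /orP[/eqP-> //|]; rewrite ltnS => lenm.
have uE : u m = 1 - fpsX ^+ (a + b * m) by rewrite /u -exprM -exprD.
rewrite big_ord_recr /= uE mulrBr mulr1 coefBfps (IHm lenm) coefMfps big1 ?subr0 // => i _.
suff /negbTE nk : (n - i != a + b * m)%N by rewrite coef_fpsXn nk mulr0.
rewrite neq_ltn.
rewrite (leq_ltn_trans (leq_subr _ _)) // (leq_ltn_trans lenm) //.
by rewrite -[m.+1]add1n leq_add // leq_pmull.
Qed.

Lemma qpoch_coef0 (a b : nat) : (0 < a)%N -> (0 < b)%N ->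
  (qpoch (fpsX ^+ a) (fpsX ^+ b))`[0] = 1.
Proof.
move=> a0 b0; have [N /(_ N (leqnn N)) <-] := qpoch_cvg a0 b0 0%N.
elim/big_ind: _ => // [u v u0 v0|k _]; first by rewrite coef0Mfps u0 v0 mulr1.
rewrite -exprM -exprD coefBfps coef_fpsXn.
by case: a a0 => // a _; rewrite addSn subr0.
Qed.

End InfiniteProducts.

Arguments fpsX {R}.

Lemma qpoch_unit (R : comUnitRingType) (a b : nat) : (0 < a)%N -> (0 < b)%N ->
  (qpoch (fpsX ^+ a) (fpsX ^+ b) : fps R) \is a GRing.unit.
Proof. by move=> a0 b0; rewrite fps_unitE qpoch_coef0 ?unitr1. Qed.

Definition f (r : nat) : fps int := qpoch (fpsX ^+ r) (fpsX ^+ r).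

Definition schur_gf : fps int :=
  1 / (qpoch fpsX (fpsX ^+ 6) * qpoch (fpsX ^+ 5) (fpsX ^+ 6)
       * qpoch (fpsX ^+ 6) (fpsX ^+ 6)).

(* S(n), the number of overpartitions of n of Schur type                      *)
Definition schur_overpartitions (n : nat) : int := schur_gf`[n].

Lemma schur_overpartitions_gf : FPS schur_overpartitions = schur_gf.
Proof. by apply/fpsP. Qed.

Lemma f_unit (r : nat) : (0 < r)%N -> f r \is a GRing.unit.
Proof. by move=> r0; apply: qpoch_unit. Qed.

Lemma schur_gfE :
  schur_gf * (qpoch fpsX (fpsX ^+ 6) * qpoch (fpsX ^+ 5) (fpsX ^+ 6)
              * qpoch (fpsX ^+ 6) (fpsX ^+ 6)) = 1.
Proof.
rewrite /schur_gf divrK // !unitrM !qpoch_unit //.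
by rewrite (@qpoch_unit _ 1 6).
Qed.

(* Main.v *)
Require Import Defs.
From mathcomp Require Import all_boot all_order all_algebra.
From mathcomp Require Import ring zify.

(* Multiplying and dividing the generating function by (-q, -q^5; q^6)_oo
   turns it into (-q, -q^5, q^6; q^6)_oo / ((q^2, q^10; q^12)_oo f_6^2), whose
   denominator is even in q. By the Jacobi triple product the numerator is the
   sum of q^(3n^2 + 2n) over the integers n, and the parity of the exponent is
   that of n; the even and the odd n give two theta series, which the triple
   product turns back into products. The triple product itself is the limit of
   the q-binomial theorem, taken modulo q^k for each k. *)

Set Implicit Arguments.
Unset Strict Implicit.
Unset Printing Implicit Defensive.

Import GRing.Theory.

Local Open Scope ring_scope.

(** * Congruence of power series modulo q^k *)

Section Eqmod.
Context {R : comNzRingType}.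
Implicit Types (u v w : fps R) (k m n : nat).

Definition fps_eqmod k u v : Prop := forall i, (i < k)%N -> u`[i] = v`[i].

Lemma fps_eqmodP u v : (forall k, fps_eqmod k u v) -> u = v.
Proof. by move=> uv; apply/fpsP => n; apply: (uv n.+1). Qed.

Lemma fps_eqmod_refl k u : fps_eqmod k u u. Proof. by []. Qed.

Lemma fps_eqmod_sym k u v : fps_eqmod k u v -> fps_eqmod k v u.
Proof. by move=> uv i ik; rewrite uv. Qed.

Lemma fps_eqmod_trans k v u w :
  fps_eqmod k u v -> fps_eqmod k v w -> fps_eqmod k u w.
Proof. by move=> uv vw i ik; rewrite uv ?vw. Qed.

Lemma fps_eqmodD k u u' v v' :
  fps_eqmod k u u' -> fps_eqmod k v v' -> fps_eqmod k (u + v) (u' + v').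
Proof. by move=> uu' vv' i ik; rewrite !coefDfps uu' ?vv'. Qed.

Lemma fps_eqmodM k u u' v v' :
  fps_eqmod k u u' -> fps_eqmod k v v' -> fps_eqmod k (u * v) (u' * v').
Proof.
move=> uu' vv' i ik; rewrite !coefMfps; apply: eq_bigr => j _.
rewrite uu' ?vv' //; first exact: leq_ltn_trans (leq_subr _ _) ik.
by apply: leq_trans ik; rewrite ltn_ord.
Qed.

Lemma fps_eqmod_sum k n (F G : 'I_n -> fps R) :
    (forall i, fps_eqmod k (F i) (G i)) ->
  fps_eqmod k (\sum_i F i) (\sum_i G i).
Proof.
by move=> FG; elim/big_rec2: _ => // i u v _; apply: fps_eqmodD.
Qed.

Lemma coef_fpsXnM n u i :
  (fpsX ^+ n * u)`[i] = if (i < n)%N then 0 else u`[i - n].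
Proof.
rewrite coefMfps; case: ltnP => [lt_in|le_ni].
  rewrite big1 // => j _; rewrite coef_fpsXn.
  have /ltn_eqF-> := leq_ltn_trans (ltn_ord j : (j <= i)%N) lt_in.
  by rewrite mul0r.
rewrite (bigD1 (Ordinal (le_ni : (n < i.+1)%N))) //= coef_fpsXn eqxx mul1r.
rewrite big1 ?addr0 // => j; rewrite -val_eqE /= => /negbTE ji.
by rewrite coef_fpsXn ji mul0r.
Qed.

(** Allows negative powers of q to be cleared from an identity, although [fpsX] has no inverse. *)
Lemma fpsXn_inj n : injective (fun u => fpsX ^+ n * u).
Proof.
move=> u v /fpsP uv; apply/fpsP => i; have := uv (i + n)%N.
by rewrite !coef_fpsXnM ltnNge leq_addl addnK.
Qed.

Lemma fps_eqmod_XnM0 k n u : (k <= n)%N -> fps_eqmod k (fpsX ^+ n * u) 0.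
Proof. by move=> kn i ik; rewrite coef_fpsXnM (leq_trans ik kn). Qed.

Lemma fps_eqmod_Xn0 k n : (k <= n)%N -> fps_eqmod k (fpsX ^+ n) 0.
Proof. by rewrite -[fpsX ^+ n]mulr1; apply: fps_eqmod_XnM0. Qed.

End Eqmod.

Lemma fps_eqmod_cancel (R : comUnitRingType) k (d u v : fps R) :
  d \is a GRing.unit -> fps_eqmod k (d * u) (d * v) -> fps_eqmod k u v.
Proof.
move=> dU /(fps_eqmodM (@fps_eqmod_refl _ k d^-1)).
by rewrite !mulKr.
Qed.

(** * Finite q-Pochhammer products and their limits *)

Section PartialProducts.
Context {R : comNzRingType}.
Implicit Types (a c m n : nat).

Definition qfact a c m : fps R := \prod_(k < m) (1 - fpsX ^+ (a + c * k)).

Lemma qfactS a c m :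
  qfact a c m.+1 = qfact a c m * (1 - fpsX ^+ (a + c * m)).
Proof. by rewrite /qfact big_ord_recr. Qed.

Lemma qfact_eqmod_le a c k m : (0 < a)%N -> (0 < c)%N -> (k <= m)%N ->
  fps_eqmod k (qfact a c m) (qfact a c k).
Proof.
move=> a0 c0; elim: m => [|m IHm]; first by rewrite leqn0 => /eqP->.
rewrite leq_eqVlt => /orP[/eqP-> //|lt_km].
rewrite qfactS mulrBr mulr1 -[qfact a c k]subr0.
apply: fps_eqmodD; first exact: IHm.
move=> i ik; rewrite !coefNfps mulrC (@fps_eqmod_XnM0 _ k) //.
by nia.
Qed.

Lemma qfact_eqmod a c k m : (0 < a)%N -> (0 < c)%N -> (k <= m)%N ->
  fps_eqmod k (qfact a c m) (qpoch (fpsX ^+ a) (fpsX ^+ c)).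
Proof.
move=> a0 c0 km i ik; have [N cvgN] := @qpoch_cvg R a c a0 c0 i.
rewrite -(cvgN (maxn N m)) ?leq_maxl //.
have -> : \prod_(j < maxn N m) (1 - fpsX ^+ a * (fpsX ^+ c) ^+ j)
  = qfact a c (maxn N m) by apply: eq_bigr => j _; rewrite -exprM -exprD.
rewrite (qfact_eqmod_le (k := k)) // [RHS](qfact_eqmod_le (k := k)) //.
by rewrite leq_max km orbT.
Qed.

(** Sort the factors by the residue of their index modulo [d]; raising [m] by one adds [d]
    consecutive factors, one per residue. *)
Lemma qfact_split a c d m :
  qfact a c (d * m) = \prod_(j < d) qfact (a + c * j) (c * d) m.
Proof.
elim: m => [|m IHm].
  by rewrite muln0 /qfact big_ord0 big1 // => j _; rewrite big_ord0.
rewrite mulnS addnC {1}/qfact big_split_ord /=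
        -/(qfact a c (d * m)) IHm -big_split /=.
apply: eq_bigr => j _; rewrite qfactS.
by congr (_ * (1 - fpsX ^+ _)); ring.
Qed.

Lemma qpoch_split a c d : (0 < a)%N -> (0 < c)%N -> (0 < d)%N ->
  qpoch (fpsX ^+ a) (fpsX ^+ c)
  = \prod_(j < d) qpoch (fpsX ^+ (a + c * j)) (fpsX ^+ (c * d)) :> fps R.
Proof.
move=> a0 c0 d0; apply: fps_eqmodP => k.
have := qfact_eqmod (k := k) (m := d * k) a0 c0 (leq_pmull _ d0).
move/fps_eqmod_sym/fps_eqmod_trans; apply; rewrite qfact_split.
elim/big_rec2: _ => // j u v _; apply: fps_eqmodM; apply: qfact_eqmod => //.
  by rewrite addn_gt0 a0.
by rewrite muln_gt0 c0.
Qed.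

End PartialProducts.

(** * Gaussian binomials and the q-binomial theorem *)

Section GaussianBinomials.
Context {R : comNzRingType} (q : R).

(** The q-Pascal rule serves as definition because it is free of division and so makes sense for
    every [q] in [R]. *)
Fixpoint gauss (n i : nat) : R :=
  match n, i with
  | _, 0 => 1
  | 0, _.+1 => 0
  | n'.+1, i'.+1 => gauss n' i' + q ^+ i'.+1 * gauss n' i'.+1
  end.

Lemma gauss0 n : gauss n 0 = 1. Proof. by case: n. Qed.

Lemma gaussS n i :
  gauss n.+1 i.+1 = gauss n i + q ^+ i.+1 * gauss n i.+1.
Proof. by []. Qed.

Lemma gauss_small n i : (n < i)%N -> gauss n i = 0.
Proof.
elim: n i => [|n IHn] [|i] //; rewrite ltnS => ltni /=.
by rewrite !IHn ?mulr0 ?addr0 // ltnW.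
Qed.

Lemma gauss_diag n : gauss n n = 1.
Proof. by elim: n => //= n ->; rewrite gauss_small // mulr0 addr0. Qed.

Definition gfact n : R := \prod_(k < n) (1 - q ^+ k.+1).

Lemma gfactS n : gfact n.+1 = gfact n * (1 - q ^+ n.+1).
Proof. by rewrite /gfact big_ord_recr. Qed.

(** The quotient formula for Gaussian binomials with denominators cleared. The induction is on a
    bound for [i + j], since the Pascal rule lowers either [i] or [j]. *)
Lemma gauss_gfact i j : gauss (i + j) i * gfact i * gfact j = gfact (i + j).
Proof.
have gfact0 : gfact 0 = 1 by rewrite /gfact big_ord0.
move: {2}(i + j)%N (leqnn (i + j)) => n.
elim: n i j => [|n IHn] [|i] [|j] // len.
- by rewrite gauss0 gfact0 !mulr1.
- by rewrite gauss0 gfact0 !mul1r.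
- by rewrite gauss0 gfact0 !mul1r.
- by rewrite addn0 gauss_diag gfact0 mulr1 mul1r.
have e1 : gauss (i + j.+1) i * gfact i * gfact j.+1 = gfact (i + j.+1).
  by apply: IHn; rewrite -ltnS -addSn.
have e2 : gauss (i + j.+1) i.+1 * gfact i.+1 * gfact j = gfact (i + j.+1).
  by rewrite -addSnnS; apply: IHn; rewrite -ltnS -addnS.
rewrite addSn gaussS.
(* The two weights add up to 1 - q^(i+j+2), the last factor of the larger factorial. *)
transitivity ((1 - q ^+ i.+1) * (gauss (i + j.+1) i * gfact i * gfact j.+1)
  + q ^+ i.+1 * (1 - q ^+ j.+1) *
    (gauss (i + j.+1) i.+1 * gfact i.+1 * gfact j)).
  by rewrite !gfactS; ring.
rewrite e1 e2 gfactS -addSn (exprD q i.+1); ring.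
Qed.

(** Induction on [n] for all [v]: once the factor [u + v] is split off, the others form the same
    product with [v * q] for [v]. *)
Lemma gauss_binomial n (u v : R) :
  \prod_(k < n) (u + v * q ^+ k)
  = \sum_(i < n.+1) q ^+ 'C(i, 2) * gauss n i * v ^+ i * u ^+ (n - i).
Proof.
elim: n v => [|n IHn] v.
  by rewrite big_ord0 big_ord1 bin_small // !mulr1.
rewrite big_ord_recl expr0 mulr1.
under eq_bigr => i _ do rewrite lift0 exprS mulrA.
rewrite IHn mulrDl big_ord_recl [RHS]big_ord_recl.
rewrite bin_small // !expr0 !gauss0 !mul1r !subn0 mulrDr -addrA -exprS.
congr (_ + _).
transitivity (\sum_(i < n.+1)
    (u * (q ^+ 'C(i.+1, 2) * gauss n i.+1 * (v * q) ^+ i.+1 * u ^+ (n - i.+1))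
     + v * (q ^+ 'C(i, 2) * gauss n i * (v * q) ^+ i * u ^+ (n - i))));
  last first.
  apply: eq_bigr => i _; rewrite !lift0 subSS gaussS binS bin1 !exprD !exprMn.
  (* For [i = n] the difference [n - i.+1] is truncated, but the Gaussian binomial beside it
     vanishes. *)
  case: (ltnP i n) => [ltin|lein].
    have -> : (n - i = (n - i.+1).+1)%N by lia.
    rewrite !exprS; ring.
  rewrite (@gauss_small n i.+1) //.
  rewrite !exprS; ring.
rewrite big_split -!mulr_sumr; congr (_ + _).
  rewrite big_ord_recr /= (@gauss_small n n.+1) // mulr0 !mul0r addr0.
  congr (_ * _); apply: eq_bigr => i _; by rewrite lift0.
rewrite [in RHS]big_ord_recl bin_small // !expr0 gauss0 subn0.
by rewrite !mul1r mulrDr.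
Qed.

End GaussianBinomials.

(** * Quadratic exponents and the finite triple product *)

Lemma bin2D m n : 'C(m + n, 2) = ('C(m, 2) + 'C(n, 2) + m * n)%N.
Proof.
elim: m => [|m IHm]; first by rewrite !add0n mul0n addn0.
by rewrite addSn !binS !bin1 IHm; ring.
Qed.

Lemma sqrn_bin2 n : (n * n = 2 * 'C(n, 2) + n)%N.
Proof. by elim: n => // n IHn; rewrite binS bin1; lia. Qed.

Lemma sum_even_odd (V : nmodType) n (F : nat -> V) :
  \sum_(i < 2 * n) F i = \sum_(i < n) F (2 * i)%N + \sum_(i < n) F (2 * i).+1.
Proof.
elim: n => [|n IHn]; first by rewrite !big_ord0 addr0.
rewrite mulnS !addSn add0n !big_ord_recr /= IHn -!addrA; congr (_ + _).
by rewrite addrCA.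
Qed.

Section FiniteTripleProduct.
Context {R : comNzRingType}.
Implicit Types (a b c k m n : nat).

Definition qfactD a c m : fps R := \prod_(k < m) (1 + fpsX ^+ (a + c * k)).

(** By (1 + x)(1 - x) = 1 - x^2; this trades products with plus signs for ordinary q-Pochhammer
    products. *)
Lemma qfactD_qfact a c m :
  qfactD a c m * qfact a c m = qfact (2 * a) (2 * c) m.
Proof.
rewrite -big_split; apply: eq_bigr => k _ /=.
by rewrite -mulnA -mulnDr [(2 * _)%N]mulnC exprM; ring.
Qed.

Lemma prod_fpsX_arith a c m :
  \prod_(k < m) fpsX ^+ (a + c * k) = fpsX ^+ (a * m + c * 'C(m, 2)) :> fps R.
Proof.
elim: m => [|m IHm]; first by rewrite big_ord0 !muln0.
by rewrite big_ord_recr /= IHm -exprD binS bin1; congr (_ ^+ _); ring.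
Qed.

(** Replacing n by -n in this quadratic exchanges [a] and [b], so natural indices cover the
    bilateral series. *)
Definition theta_exp a b n := ((a + b) * 'C(n, 2) + a * n)%N.

Lemma theta_exp_ge a b n : (0 < a)%N -> (n <= theta_exp a b n)%N.
Proof. by move=> a0; rewrite (leq_trans _ (leq_addl _ _)) // leq_pmull. Qed.

(* The instance [u = q^(c m)], [v = q^a] of the q-binomial theorem, with [q^c]
   as base and [c = a + b]; the middle index [m] is the origin of both sums. *)
Lemma finite_triple_product a b m :
  qfactD a (a + b) m * qfactD b (a + b) m
  = \sum_(n < m.+1)
      fpsX ^+ theta_exp a b n * gauss (fpsX ^+ (a + b)) (m + m) (m + n)
  + \sum_(n < m)
      fpsX ^+ theta_exp b a n.+1 * gauss (fpsX ^+ (a + b)) (m + m) (m - n.+1).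
Proof.
set c := (a + b)%N; set g := gauss _ _.
(* This exponent collects the smaller power from each binomial factor: [a + c * k] for the first [m]
   factors, [c * m] for each of the other [m]. *)
apply: (@fpsXn_inj _ (a * m + c * 'C(m, 2) + c * m * m)).
have -> : fpsX ^+ (a * m + c * 'C(m, 2) + c * m * m)
      * (qfactD a c m * qfactD b c m)
    = \prod_(k < m + m) (fpsX ^+ (c * m) + fpsX ^+ a * (fpsX ^+ c) ^+ k).
  rewrite big_split_ord /=.
  have -> : \prod_(k < m) (fpsX ^+ (c * m) + fpsX ^+ a * (fpsX ^+ c) ^+ k)
      = fpsX ^+ (a * m + c * 'C(m, 2)) * qfactD b c m.
    (* Reversal matches the factors, since [c * m = (a + c * k) + (b + c * (m - k.+1))]. *)
    rewrite -prod_fpsX_arith /qfactD [X in _ * X](reindex_inj rev_ord_inj).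
    rewrite -big_split; apply: eq_bigr => k _ /=.
    rewrite -exprM -exprD mulrDr mulr1 -exprD addrC; congr (_ + _ ^+ _).
    by have := ltn_ord k; rewrite /c; nia.
  have -> : \prod_(k < m) (fpsX ^+ (c * m) + fpsX ^+ a * (fpsX ^+ c) ^+ (m + k))
      = fpsX ^+ (c * m * m) * qfactD a c m.
    have -> : fpsX ^+ (c * m * m) = \prod_(k < m) fpsX ^+ (c * m) :> fps R.
      by rewrite prodr_const card_ord exprM.
    rewrite -big_split; apply: eq_bigr => k _ /=.
    rewrite mulrDr mulr1 -exprD -exprM -exprD; congr (_ + _ ^+ _); ring.
  by rewrite [in LHS]exprD; ring.
rewrite gauss_binomial -addnS big_split_ord /= addrC mulrDr !mulr_sumr.
have shuffle (A B C D E G : fps R) :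
    A * B * C = D * E -> A * G * B * C = D * (E * G).
  by move=> ABC; rewrite mulrA -ABC; ring.
congr (_ + _).
  apply: eq_bigr => n _; apply: shuffle.
  rewrite -!exprM -!exprD; congr (_ ^+ _).
  (* Writing [m = i + j] removes the truncated subtractions from the exponents. *)
  have := subnKC (ltn_ord n : (n <= m)%N).
  move: (nat_of_ord n) => i; move: (m - i)%N => j <-; rewrite /theta_exp -/c.
  have -> : (i + j + (i + j) - (i + j + i) = j)%N by lia.
  by rewrite !bin2D; ring.
rewrite (reindex_inj rev_ord_inj); apply: eq_bigr => n _ /=.
apply: shuffle; rewrite -!exprM -!exprD; congr (_ ^+ _).
have := subnKC (ltn_ord n).
move: (nat_of_ord n).+1 => i; move: (m - i)%N => j <-.
rewrite /theta_exp [(b + a)%N]addnC -/c.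
have -> : (i + j + (i + j) - j = i + i + j)%N by lia.
rewrite !bin2D; have := sqrn_bin2 i; rewrite /c.
move: 'C(i, 2) 'C(j, 2) => x y H.
(* Isolating [i * i] allows [sqrn_bin2] to express it through the binomial, which [ring] treats as a
   variable. *)
have -> : ((a + b) * (i + j) * (i + i + j)
  = (a + b) * (i * i) + (a + b) * (i * i) + (a + b) * (3 * i * j + j * j))%N
  by ring.
have -> : ((a + b) * (i + j) * (i + j)
  = (a + b) * (i * i) + (a + b) * (2 * i * j + j * j))%N by ring.
rewrite H; ring.
Qed.

End FiniteTripleProduct.

(** * Ramanujan's theta function and its 2-dissection *)

Section Theta.
Context {R : comNzRingType}.
Implicit Types (a b k m n : nat).

(** The symmetric truncation to indices from -m to m. *)
Definition theta_sum a b m : fps R :=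
  \sum_(n < m.+1) fpsX ^+ theta_exp a b n
  + \sum_(n < m) fpsX ^+ theta_exp b a n.+1.

(* Ramanujan's theta function: the sum of [q^((a+b) n(n-1)/2 + a n)] over all
   integers [n]; the terms with [n < 0] form the second sum of [theta_sum]. *)
Definition theta a b : fps R := FPS (fun n => (theta_sum a b n.+1)`[n]).

Lemma theta_sumC a b m : theta_sum a b m = theta_sum b a m.
Proof.
rewrite /theta_sum !big_ord_recl /theta_exp bin0n !muln0.
under [in RHS]eq_bigr => n _ do rewrite lift0.
under [X in _ + X + _]eq_bigr => n _ do rewrite lift0.
by rewrite -!addrA; congr (_ + _); apply: addrC.
Qed.

Lemma theta_sum_eqmod_le a b k m : (0 < a)%N -> (0 < b)%N -> (k <= m)%N ->
  fps_eqmod k (theta_sum a b m) (theta_sum a b k).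
Proof.
move=> a0 b0; elim: m => [|m IHm]; first by rewrite leqn0 => /eqP->.
rewrite leq_eqVlt => /orP[/eqP-> //|le_km].
apply: fps_eqmod_trans (IHm le_km).
rewrite /theta_sum big_ord_recr [X in _ + X]big_ord_recr /=.
rewrite -[X in fps_eqmod _ _ X]addr0 addrACA; apply: fps_eqmodD => //; rewrite -[0]addr0.
by apply: fps_eqmodD; apply: fps_eqmod_Xn0;
  apply: leq_trans (theta_exp_ge _ _ _) => //; lia.
Qed.

Lemma theta_sum_eqmod a b k m : (0 < a)%N -> (0 < b)%N -> (k <= m)%N ->
  fps_eqmod k (theta_sum a b m) (theta a b).
Proof.
move=> a0 b0 km i ik.
exact: (theta_sum_eqmod_le (k := i.+1) a0 b0 (leq_trans ik km)).
Qed.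

Lemma theta_exp_even a b n :
  theta_exp a b (2 * n) = theta_exp (3 * a + b) (a + 3 * b) n.
Proof.
rewrite /theta_exp mul2n -addnn bin2D sqrn_bin2; ring.
Qed.

(** For odd indices of f(q^a, q^b) the new parameters are 5a + 3b and b - a; putting b = a + d keeps
    both natural. *)
Lemma theta_exp_oddl a d n :
  theta_exp a (a + d) (2 * n).+1 = (a + theta_exp (8 * a + 3 * d) d n)%N.
Proof.
rewrite /theta_exp binS bin1 mul2n -addnn bin2D sqrn_bin2; ring.
Qed.

Lemma theta_exp_oddr a d n :
  theta_exp (a + d) a (2 * n).+1 = (a + theta_exp d (8 * a + 3 * d) n.+1)%N.
Proof.
rewrite /theta_exp !binS !bin1 mul2n -addnn bin2D sqrn_bin2; ring.
Qed.

Lemma theta_dissection a d : (0 < a)%N -> (0 < d)%N ->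
  theta a (a + d)
  = theta (3 * a + (a + d)) (a + 3 * (a + d))
    + fpsX ^+ a * theta d (8 * a + 3 * d).
Proof.
move=> a0 d0; set e := (8 * a + 3 * d)%N; apply: fps_eqmodP => k.
have ad0 : (0 < a + d)%N by rewrite addn_gt0 a0.
apply: fps_eqmod_trans (fps_eqmod_sym _)
  (_ : fps_eqmod k (theta_sum a (a + d) (2 * k)) _).
  by apply: theta_sum_eqmod; lia.
apply: (fps_eqmod_trans (v := theta_sum (3 * a + (a + d)) (a + 3 * (a + d)) k
    + fpsX ^+ a * theta_sum d e k)); last first.
  apply: fps_eqmodD; first by apply: theta_sum_eqmod; lia.
  by apply: fps_eqmodM => //; apply: theta_sum_eqmod; rewrite /e; lia.
(* The truncations differ by one term: the indices up to 2k in absolute value contain the odd ones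
   from 1 - 2k to 2k - 1, while [theta_sum d e k] also has 2k + 1. Its exponent is at least [k]. *)
have -> : theta_sum (3 * a + (a + d)) (a + 3 * (a + d)) k
    + fpsX ^+ a * theta_sum d e k
    = theta_sum a (a + d) (2 * k) + fpsX ^+ (a + theta_exp e d k).
  pose F := theta_exp a (a + d); pose G := theta_exp (a + d) a.
  have -> : theta_sum a (a + d) (2 * k) = \sum_(n < (2 * k).+1) fpsX ^+ F n
      + \sum_(n < 2 * k) fpsX ^+ G n.+1 by [].
  rewrite big_ord_recr /= (sum_even_odd k (fun n => fpsX ^+ F n)).
  rewrite (sum_even_odd k (fun n => fpsX ^+ G n.+1)).
  rewrite [theta_sum d e k]theta_sumC /theta_sum mulrDr !mulr_sumr.
  have -> : \sum_(n < k.+1)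
        fpsX ^+ theta_exp (3 * a + (a + d)) (a + 3 * (a + d)) n
      = \sum_(n < k) fpsX ^+ F (2 * n)%N + fpsX ^+ F (2 * k)%N :> fps R.
    rewrite big_ord_recr /= /F theta_exp_even; congr (_ + _).
    by apply: eq_bigr => n _; rewrite theta_exp_even.
  have -> : \sum_(n < k)
        fpsX ^+ theta_exp (a + 3 * (a + d)) (3 * a + (a + d)) n.+1
      = \sum_(n < k) fpsX ^+ G (2 * n).+2 :> fps R.
    apply: eq_bigr => n _; rewrite /G -[(2 * n).+2]/(2 + 2 * n)%N -mulnS.
    by rewrite theta_exp_even [(3 * _ + a)%N]addnC [(a + d + _)%N]addnC.
  have -> : \sum_(n < k.+1) fpsX ^+ a * fpsX ^+ theta_exp e d n
      = \sum_(n < k) fpsX ^+ F (2 * n).+1 + fpsX ^+ (a + theta_exp e d k)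
        :> fps R.
    rewrite big_ord_recr /= exprD; congr (_ + _).
    by apply: eq_bigr => n _; rewrite /F theta_exp_oddl exprD.
  have -> : \sum_(n < k) fpsX ^+ a * fpsX ^+ theta_exp d e n.+1
      = \sum_(n < k) fpsX ^+ G (2 * n).+1 :> fps R.
    by apply: eq_bigr => n _; rewrite /G theta_exp_oddr exprD.
  ring.
rewrite -[X in fps_eqmod _ X]addr0; apply: fps_eqmodD => //.
apply: fps_eqmod_sym; apply: fps_eqmod_Xn0.
apply: leq_trans (theta_exp_ge d _ _) (leq_addl _ _).
by rewrite /e; lia.
Qed.

End Theta.

(** * The Jacobi triple product *)

Section TripleProduct.
Context {R : comUnitRingType}.
Implicit Types (a b c k m n : nat).

Lemma gfact_qfact c n : gfact (fpsX ^+ c) n = qfact c c n :> fps R.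
Proof. by apply: eq_bigr => k _; rewrite -exprM mulnS. Qed.

(** In the quotient formula all three factorials agree with the infinite product modulo q^k, so the
    quotient is its inverse there. *)
Lemma gauss_eqmod c i j k : (0 < c)%N -> (k <= i)%N -> (k <= j)%N ->
  fps_eqmod k
    (gauss (fpsX ^+ c) (i + j) i * qpoch (fpsX ^+ c) (fpsX ^+ c) : fps R) 1.
Proof.
move=> c0 ki kj; set P := qpoch _ _.
apply: (@fps_eqmod_cancel _ _ P); first exact: qpoch_unit.
have qP m : (k <= m)%N -> fps_eqmod k (qfact c c m) P by exact: qfact_eqmod.
rewrite mulr1; apply: fps_eqmod_trans (qP (i + j)%N _); last lia.
rewrite -gfact_qfact -gauss_gfact !gfact_qfact mulrC.
by apply: fps_eqmodM; [apply: fps_eqmodM => //|]; apply/fps_eqmod_sym/qP.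
Qed.

(** The usual identity multiplied by (q^a, q^b; q^(a+b))_oo, which turns (-q^a, -q^b; q^(a+b))_oo
    into Pochhammer products without signs. *)
Lemma triple_product a b : (0 < a)%N -> (0 < b)%N ->
  theta a b * (qpoch (fpsX ^+ a) (fpsX ^+ (a + b))
               * qpoch (fpsX ^+ b) (fpsX ^+ (a + b)))
  = qpoch (fpsX ^+ (2 * a)) (fpsX ^+ (2 * (a + b)))
    * qpoch (fpsX ^+ (2 * b)) (fpsX ^+ (2 * (a + b)))
    * qpoch (fpsX ^+ (a + b)) (fpsX ^+ (a + b)) :> fps R.
Proof.
move=> a0 b0; apply: fps_eqmodP => k; set c := (a + b)%N.
have c0 : (0 < c)%N by rewrite addn_gt0 a0.
(* With [m = 2k], every index within [k] of the middle is at distance at least [k] from both ends,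
   as [gauss_eqmod] demands; terms further out have exponent at least [k]. *)
set P := qpoch (fpsX ^+ c) _; pose m := (k + k)%N.
have km : (k <= m)%N by rewrite leq_addl.
have qP x y : (0 < x)%N -> (0 < y)%N ->
    fps_eqmod k (qpoch (fpsX ^+ x) (fpsX ^+ y) : fps R) (qfact x y m).
  by move=> x0 y0; apply/fps_eqmod_sym/qfact_eqmod.
have thetaP : fps_eqmod k (theta_sum a b m) (qfactD a c m * qfactD b c m * P).
  rewrite finite_triple_product mulrDl !mulr_suml.
  apply: fps_eqmodD; apply: fps_eqmod_sum => -[n ltnm] /=.
    have [lekn|ltnk] := leqP k n.
      have kt : (k <= theta_exp a b n)%N.
        exact: leq_trans (theta_exp_ge _ _ _).
      rewrite -mulrA; apply: fps_eqmod_trans (fps_eqmod_Xn0 kt) _.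
      exact/fps_eqmod_sym/fps_eqmod_XnM0.
    rewrite -mulrA -[X in fps_eqmod _ X]mulr1; apply: fps_eqmodM => //.
    apply: fps_eqmod_sym; rewrite -[(m + m)%N](@subnKC (m + n)); last by lia.
    by apply: gauss_eqmod => //; rewrite /m; lia.
  have [lekn|ltnk] := leqP k n.
    have kt : (k <= theta_exp b a n.+1)%N.
      by apply: leq_trans (theta_exp_ge _ _ _) => //; apply: leqW.
    rewrite -mulrA; apply: fps_eqmod_trans (fps_eqmod_Xn0 kt) _.
    exact/fps_eqmod_sym/fps_eqmod_XnM0.
  rewrite -mulrA -[X in fps_eqmod _ X]mulr1; apply: fps_eqmodM => //.
  apply: fps_eqmod_sym; rewrite -[(m + m)%N](@subnKC (m - n.+1)); last by lia.
  by apply: gauss_eqmod => //; rewrite /m; lia.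
clearbody P; apply: (fps_eqmod_trans
  (v := qfactD a c m * qfactD b c m * P * (qfact a c m * qfact b c m))).
  apply: fps_eqmodM; last by apply: fps_eqmodM; apply: qP.
  exact: fps_eqmod_trans (fps_eqmod_sym (theta_sum_eqmod _ _ km)) thetaP.
rewrite mulrAC mulrACA; apply: fps_eqmodM; last exact: fps_eqmod_refl.
by apply: fps_eqmodM; rewrite qfactD_qfact;
  apply/fps_eqmod_sym/qP; rewrite ?muln_gt0.
Qed.

End TripleProduct.

(** * The substitution of q^2 for q *)

Section Dilation.
Context {R : comNzRingType}.
Implicit Types (u v : fps R).

(* The substitution of [q^2] for [q]. *)
Definition fps_dbl u : fps R := FPS (fun n => if odd n then 0 else u`[n./2]).

Lemma coef_dbl_even u n : (fps_dbl u)`[2 * n] = u`[n].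
Proof. by rewrite /fps_coef /= mul2n odd_double doubleK. Qed.

Lemma coef_dbl_odd u n : (fps_dbl u)`[(2 * n).+1] = 0.
Proof. by rewrite /fps_coef /= mul2n odd_double. Qed.

Lemma fps_even_oddP u v :
    (forall n, u`[2 * n] = v`[2 * n]) ->
    (forall n, u`[(2 * n).+1] = v`[(2 * n).+1]) -> u = v.
Proof.
move=> uv0 uv1; apply/fpsP => n; rewrite -(odd_double_half n) -mul2n.
by case: (odd n); [apply: uv1 | apply: uv0].
Qed.

(** In an even coefficient of the product only pairs of even indices survive; in an odd one, each
    pair contains an odd index. *)
Lemma fps_dblM u v : fps_dbl (u * v) = fps_dbl u * fps_dbl v.
Proof.
apply: fps_even_oddP => n; rewrite ?coef_dbl_even ?coef_dbl_odd !coefMfps.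
  rewrite [RHS]big_ord_recr /= subnn.
  rewrite (sum_even_odd n (fun i => (fps_dbl u)`[i] * (fps_dbl v)`[2 * n - i])).
  rewrite [X in _ + X + _]big1 => [|i _]; last by rewrite coef_dbl_odd mul0r.
  rewrite addr0 [LHS]big_ord_recr /= subnn coef_dbl_even.
  rewrite (coef_dbl_even v 0 : (fps_dbl v)`[0] = _).
  congr (_ + _); apply: eq_bigr => i _.
  by rewrite -mulnBr !coef_dbl_even.
rewrite (_ : (2 * n).+2 = 2 * n.+1)%N; last by rewrite mulnS.
rewrite (sum_even_odd n.+1
  (fun i => (fps_dbl u)`[i] * (fps_dbl v)`[(2 * n).+1 - i])) !big1 ?addr0 //.
  by move=> i _; rewrite coef_dbl_odd mul0r.
move=> i _; rewrite subSn; last by have := ltn_ord i; lia.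
by rewrite -mulnBr coef_dbl_odd mulr0.
Qed.

Lemma fps_dbl_1BXn n : fps_dbl (1 - fpsX ^+ n) = 1 - fpsX ^+ (2 * n).
Proof.
apply: fps_even_oddP => k; rewrite ?coef_dbl_even ?coef_dbl_odd !coefBfps.
  rewrite !coef1fps !coef_fpsXn; congr (_%:R - _%:R); lia.
rewrite coef1fps coef_fpsXn (_ : (_ == 2 * n)%N = false) ?subrr //; lia.
Qed.

Lemma fps_dbl_qfact a c m : fps_dbl (qfact a c m) = qfact (2 * a) (2 * c) m.
Proof.
elim: m => [|m IHm].
  rewrite /qfact !big_ord0; apply: fps_even_oddP => k.
    by rewrite coef_dbl_even !coef1fps; congr (_%:R); lia.
  by rewrite coef_dbl_odd.
by rewrite !qfactS fps_dblM IHm fps_dbl_1BXn mulnDr mulnA.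
Qed.

Lemma fps_eqmod_dbl k u v :
  fps_eqmod k u v -> fps_eqmod k (fps_dbl u) (fps_dbl v).
Proof.
move=> uv i ik; rewrite /fps_coef /=; case: odd => //; apply: uv.
by apply: leq_ltn_trans ik; rewrite leq_half_double; lia.
Qed.

Lemma fps_dbl_qpoch a c : (0 < a)%N -> (0 < c)%N ->
  fps_dbl (qpoch (fpsX ^+ a) (fpsX ^+ c))
  = qpoch (fpsX ^+ (2 * a)) (fpsX ^+ (2 * c)).
Proof.
move=> a0 c0; apply: fps_eqmodP => k.
apply: (fps_eqmod_trans (v := qfact (2 * a) (2 * c) k)); last first.
  by apply: qfact_eqmod; rewrite ?muln_gt0.
by rewrite -fps_dbl_qfact; apply/fps_eqmod_dbl/fps_eqmod_sym/qfact_eqmod.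
Qed.

End Dilation.

(* In this form, applying the lemma to a product of [f r]'s never makes
   unification unfold [f]. *)
Lemma fps_dblM_eq (R : comNzRingType) (u v u' v' : fps R) :
  fps_dbl u = u' -> fps_dbl v = v' -> fps_dbl (u * v) = u' * v'.
Proof. by move=> <- <-; rewrite fps_dblM. Qed.

Lemma fps_dbl_div (R : comUnitRingType) (u v u' v' : fps R) :
    v \is a GRing.unit -> fps_dbl u = u' -> fps_dbl v = v' ->
  fps_dbl (u / v) * v' = u'.
Proof. by move=> vU <- <-; rewrite -fps_dblM divrK. Qed.

(** * Theta functions as quotients of the [f r] *)

Section EtaQuotients.
Implicit Types a c r : nat.

Lemma qpoch_split2 (R : comNzRingType) a c : (0 < a)%N -> (0 < c)%N ->
  qpoch (fpsX ^+ a) (fpsX ^+ c)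
  = qpoch (fpsX ^+ a) (fpsX ^+ (2 * c))
    * qpoch (fpsX ^+ (a + c)) (fpsX ^+ (2 * c)) :> fps R.
Proof.
move=> a0 c0; have prod2 (F : nat -> fps R) : \prod_(j < 2) F j = F 0 * F 1.
  by rewrite !big_ord_recl big_ord0 mulr1.
rewrite (qpoch_split a0 c0 (ltn0Sn 1)).
rewrite (prod2 (fun j => qpoch (fpsX ^+ (a + c * j)) (fpsX ^+ (c * 2)))).
by rewrite muln0 addn0 muln1 [(c * 2)%N]mulnC.
Qed.

Lemma qpoch_split3 (R : comNzRingType) a c : (0 < a)%N -> (0 < c)%N ->
  qpoch (fpsX ^+ a) (fpsX ^+ c)
  = qpoch (fpsX ^+ a) (fpsX ^+ (3 * c))
    * qpoch (fpsX ^+ (a + c)) (fpsX ^+ (3 * c))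
    * qpoch (fpsX ^+ (a + c * 2)) (fpsX ^+ (3 * c)) :> fps R.
Proof.
move=> a0 c0; have prod3 (F : nat -> fps R) :
    \prod_(j < 3) F j = F 0 * F 1 * F 2.
  by rewrite !big_ord_recl big_ord0 mulr1 mulrA.
rewrite (qpoch_split a0 c0 (ltn0Sn 2)).
rewrite (prod3 (fun j => qpoch (fpsX ^+ (a + c * j)) (fpsX ^+ (c * 3)))).
by rewrite muln0 addn0 muln1 [(c * 3)%N]mulnC.
Qed.

Lemma fps_dbl_f r : (0 < r)%N -> fps_dbl (f r) = f (2 * r).
Proof. by move=> r0; apply: fps_dbl_qpoch. Qed.

Lemma f_split2 r : (0 < r)%N ->
  f r = qpoch (fpsX ^+ r) (fpsX ^+ (2 * r)) * f (2 * r).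
Proof. by move=> r0; rewrite {1}/f qpoch_split2 // addnn -mul2n. Qed.

Lemma f_split3 r : (0 < r)%N ->
  f r = qpoch (fpsX ^+ r) (fpsX ^+ (3 * r))
        * qpoch (fpsX ^+ (2 * r)) (fpsX ^+ (3 * r)) * f (3 * r).
Proof.
move=> r0; rewrite {1}/f qpoch_split3 // addnn -mul2n.
by rewrite (_ : r + r * 2 = 3 * r)%N //; lia.
Qed.

(** From (q^r; q^(2r))_oo, which is [f r / f (2 * r)], remove the multiples of 3r, which form
    [f (3 * r) / f (6 * r)]; residues 1 and 5 modulo 6 remain. *)
Lemma f_split6 r : (0 < r)%N ->
  qpoch (fpsX ^+ r) (fpsX ^+ (6 * r))
    * qpoch (fpsX ^+ (5 * r)) (fpsX ^+ (6 * r)) * (f (2 * r) * f (3 * r))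
  = f r * f (6 * r).
Proof.
move=> r0; have r2 : (0 < 2 * r)%N by rewrite muln_gt0.
have r3 : (0 < 3 * r)%N by rewrite muln_gt0.
rewrite (f_split2 r0) (f_split2 r3) (qpoch_split3 _ r0 r2).
rewrite (_ : r + 2 * r = 3 * r)%N; last by lia.
rewrite (_ : r + 2 * r * 2 = 5 * r)%N; last by lia.
rewrite (_ : 3 * (2 * r) = 6 * r)%N; last by lia.
rewrite (_ : 2 * (3 * r) = 6 * r)%N; last by lia.
move: (f (2 * r)) (f (6 * r)) (qpoch _ _) (qpoch _ _) (qpoch _ _) => u v x y z.
ring.
Qed.

Lemma theta_r_2r r : (0 < r)%N ->
  theta r (2 * r) * (f r * f (6 * r)) = f (2 * r) * f (3 * r) ^+ 2.
Proof.
move=> r0; have r2 : (0 < 2 * r)%N by rewrite muln_gt0.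
have := triple_product (R := int) r0 r2.
rewrite (_ : r + 2 * r = 3 * r)%N; last by lia.
rewrite (f_split3 r0) (f_split3 r2) !mulnA -/(f (3 * r)).
move: (f (3 * r)) (f (6 * r)) (theta _ _) => u v t.
move: (qpoch _ _) (qpoch _ _) (qpoch _ _) (qpoch _ _) => w z y x e.
by transitivity (t * (x * y) * u * v); [ring | rewrite e; ring].
Qed.

(** In the triple product, [f_split6] at [r] and at [2 * r] evaluates the Pochhammer pairs on the
    two sides. *)
Lemma theta_r_5r r : (0 < r)%N ->
  theta r (5 * r) * (f r * f (4 * r) * f (6 * r))
  = f (2 * r) ^+ 2 * f (3 * r) * f (12 * r).
Proof.
move=> r0; have r2 : (0 < 2 * r)%N by rewrite muln_gt0.
have r5 : (0 < 5 * r)%N by rewrite muln_gt0.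
have := triple_product (R := int) r0 r5.
rewrite (_ : r + 5 * r = 6 * r)%N; last by lia.
have := f_split6 r0; have := f_split6 r2.
rewrite !mulnA -/(f (6 * r)).
have : f (6 * r) \is a GRing.unit by rewrite f_unit // muln_gt0.
move: (f r) (f (2 * r)) (f (3 * r)) (f (4 * r)) (f (6 * r)) (f (12 * r)).
move: (theta _ _).
move=> t f1 f2 f3 f4 f6 f12.
move: (qpoch _ _) (qpoch _ _) (qpoch _ _) (qpoch _ _) => w z y x f6U e2 e1 et.
apply: (mulIr f6U).
transitivity (t * (f1 * f6) * (f4 * f6)); first by ring.
rewrite -e1; transitivity (t * (z * w) * (f2 * f3) * (f4 * f6)); first by ring.
rewrite et.
transitivity ((x * y * (f4 * f6)) * f6 * f2 * f3); first by ring.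
rewrite e2; ring.
Qed.

End EtaQuotients.

(** * The parity dissection of the generating function *)

(** All the [f r] here are even in q, so dissecting [schur_gf] reduces to dissecting [theta 1 5]. *)
Lemma schur_gf_theta : schur_gf * (f 2 * f 6 * f 12) = theta 1 5 * f 4.
Proof.
have := theta_r_5r (ltn0Sn 0); have := f_split6 (ltn0Sn 0); have := schur_gfE.
rewrite !muln1 -[qpoch (fpsX ^+ 6) _]/(f 6) -[fpsX ^+ 1]/fpsX.
have : f 1 * f 6 \is a GRing.unit by apply: rpredM; apply: f_unit.
move: (theta _ _) schur_gf (qpoch _ _) (qpoch _ _) => t g y x.
move: (f 1) (f 2) (f 3) (f 4) (f 6) (f 12) => f1 f2 f3 f4 f6 f12 dU eg e6 et.
apply: (mulIr dU); transitivity (f2 ^+ 2 * f3 * f12); last by rewrite -et; ring.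
rewrite -e6; transitivity (g * (x * y * f6) * (f2 ^+ 2 * f3 * f12)).
  by ring.
by rewrite eg mul1r.
Qed.

Theorem theorem3p1 :
  FPS (fun n : nat => schur_overpartitions (2 * n)%N)
    = (f 2 * f 8 * f 12 ^+ 2) / (f 1 * f 3 * f 4 * f 6 * f 24)
  /\ FPS (fun n : nat => schur_overpartitions (2 * n + 1)%N)
    = (f 4 ^+ 2 * f 24) / (f 1 * f 3 * f 8 * f 12).
Proof.
set A := (X in _ = X /\ _); set B := (X in _ /\ _ = X).
(* The summands A(q^2) and q B(q^2) have only even and only odd powers, so both claims can be read
   off. *)
suff gfE : schur_gf = fps_dbl A + fpsX ^+ 1 * fps_dbl B.
  split; apply/fpsP => n; rewrite [LHS]/fps_coef /= /schur_overpartitions gfE.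
    rewrite coefDfps coef_dbl_even coef_fpsXnM.
    case: n => [|n]; first by rewrite addr0.
    rewrite (_ : 2 * n.+1 = (2 * n).+2)%N ?mulnS //=.
    by rewrite subSS subn0 coef_dbl_odd addr0.
  by rewrite addn1 coefDfps coef_dbl_odd coef_fpsXnM subSS subn0
          coef_dbl_even add0r.
have AE : fps_dbl A * (f 2 * f 6 * f 8 * f 12 * f 48) = f 4 * f 16 * f 24 ^+ 2.
  apply: fps_dbl_div; first by do !apply: rpredM; apply: f_unit.
    by do !apply: fps_dblM_eq; apply: fps_dbl_f.
  by do !apply: fps_dblM_eq; apply: fps_dbl_f.
have BE : fps_dbl B * (f 2 * f 6 * f 16 * f 24) = f 8 ^+ 2 * f 48.
  apply: fps_dbl_div; first by do !apply: rpredM; apply: f_unit.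
    by do !apply: fps_dblM_eq; apply: fps_dbl_f.
  by do !apply: fps_dblM_eq; apply: fps_dbl_f.
have t8E : theta 8 16 * (f 8 * f 48) = f 16 * f 24 ^+ 2.
  exact: (theta_r_2r (r := 8)).
have t4E : theta 4 20 * (f 4 * f 16 * f 24) = f 8 ^+ 2 * f 12 * f 48.
  exact: (theta_r_5r (r := 4)).
have t1E : theta 1 5 = theta 8 16 + fpsX ^+ 1 * theta 4 20 :> fps int.
  exact: (theta_dissection (a := 1) (d := 4)).
(* The common denominator of [schur_gf_theta], [t8E] and [t4E]. *)
have dU : f 2 * f 6 * f 12 * (f 8 * f 48) * (f 4 * f 16 * f 24)
    \is a GRing.unit by do !apply: rpredM; apply: f_unit.
move: AE BE t8E t4E t1E dU schur_gf_theta.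
(* With every series a variable, the rest is polynomial algebra from the five relations. *)
generalize (fps_dbl A) (fps_dbl B) (theta 1 5 : fps int).
generalize (theta 8 16 : fps int) (theta 4 20 : fps int) schur_gf.
generalize (fpsX ^+ 1 : fps int) (f 2) (f 4) (f 6) (f 8) (f 12) (f 16) (f 24).
move: (f 48) => f48 x f2 f4 f6 f8 f12 f16 f24 t8 t4 g a b t1.
move=> AE BE t8E t4E -> dU gE.
apply: (mulIr dU).
transitivity (g * (f2 * f6 * f12) * (f8 * f48) * (f4 * f16 * f24)).
  by ring.
rewrite gE.
transitivity (t8 * (f8 * f48) * f4 * (f4 * f16 * f24)
  + x * (t4 * (f4 * f16 * f24)) * f4 * (f8 * f48)); first by ring.
rewrite t8E t4E.
transitivity (a * (f2 * f6 * f8 * f12 * f48) * (f4 * f16 * f24)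
  + x * (b * (f2 * f6 * f16 * f24)) * (f12 * (f8 * f48) * f4)).
  rewrite AE BE; ring.
ring.
Qed.
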